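(* Let $(X,d)$ be a geodesic space. If $(X\times X,d^2)$ is an NNCC space, then $(X,d)$ is a positively curved space in the sense of Alexandrov (PC space).
   Context: A complete metric space $(X,d)$ is a geodesic space if for any $x_0,x_1\in X$, $d(x_0,x_1)$ equals the minimum (which is attained) of the lengths of continuous curves $\gamma\colon[0,1]\to X$ connecting $x_0$ to $x_1$, where $\operatorname{Length}(\gamma)=\sup\sum_{k=1}^N d(\gamma(t_k),\gamma(t_{k-1}))$ over partitions $0=t_0<\dots<t_N=1$. Minimizers are called geodesics and are always parametrized with constant speed: $d(\gamma(s),\gamma(r))=|s-r|\,d(x_0,x_1)$ for $s,r\in[0,1]$. A geodesic space $(X,d)$ is a PC space if for any $y\in X$, any geodesic $\gamma$ and all $s\in[0,1]$, $$d^2(\gamma(s),y)\ge(1-s)d^2(\gamma(0),y)+s\,d^2(\gamma(1),y)-s(1-s)d^2(\gamma(0),\gamma(1)).$$ For sets $X,Y$ and a (here finite) cost $c\colon X\times Y\to\mathbb R$, a pair $(\mathrm x,\bar y)$ with $\mathrm x\colon[0,1]\to X$ an arbitrary function (no continuity required) and $\bar y\in Y$ is a variational c-segment if for all $s\in(0,1)$ and $y\in Y$, $$c(\mathrm x(s),\bar y)-c(\mathrm x(s),y)\le (1-s)[c(\mathrm x(0),\bar y)-c(\mathrm x(0),y)]+s[c(\mathrm x(1),\bar y)-c(\mathrm x(1),y)].$$ $(X\times Y,c)$ is an NNCC space if for every $(x_0,x_1,\bar y)\in X\times X\times Y$ there exists a variational c-segment $(\mathrm x,\bar y)$ with $\mathrm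 x(0)=x_0$ and $\mathrm x(1)=x_1$. Here $Y=X$ and $c=d^2$. *)

(* Defs.v *)
From HB Require Import structures.
From mathcomp Require Import all_boot all_order all_algebra.
From mathcomp Require Import all_classical all_reals all_analysis.
Set Implicit Arguments.
Unset Strict Implicit.
Unset Printing Implicit Defensive.
Import Order.TTheory GRing.Theory Num.Theory.
Import numFieldNormedType.Exports.
Local Open Scope classical_set_scope.
Local Open Scope ring_scope.

(* Functions on the unit interval are represented by functions on the whole
   of R; no definition below depends on their values outside [0, 1]. *)

Section geodesic_spaces.
Context {R : realType} (X : metricType R).
Implicit Types (x : X) (g : R -> X).

(* The content of the library's completeType, which in addition requires its
   carrier to be pointed; a metric space here may be empty. *)
Definition complete_space : Prop :=
  forall F : set_system X, ProperFilter F -> cauchy F ->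
    exists x, F --> x.

Definition connecting_curve x0 x1 g : Prop :=
  [/\ {within `[0, 1], continuous g}, g 0 = x0 & g 1 = x1].

(* [itv_partition 0 1 t] means that 0 < t_1 < ... < t_N = 1 where N = size t;
   the point t_0 = 0 is not part of the list. *)
Definition polygonal_length g (t : seq R) : R :=
  \sum_(1 <= k < (size t).+1)
    mdist (g (nth 0 (0 :: t) k)) (g (nth 0 (0 :: t) k.-1)).

Definition curve_length g : \bar R :=
  ereal_sup [set (polygonal_length g t)%:E | t in [set t | itv_partition 0 1 t]].

Definition geodesic_space : Prop :=
  complete_space /\
  forall x0 x1,
    (exists2 g, connecting_curve x0 x1 g & curve_length g = (mdist x0 x1)%:E) /\
    (forall g, connecting_curve x0 x1 g ->
       ((mdist x0 x1)%:E <= curve_length g)%E).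

Definition length_minimizer g : Prop :=
  connecting_curve (g 0) (g 1) g /\
  forall h, connecting_curve (g 0) (g 1) h ->
    (curve_length g <= curve_length h)%E.

Definition constant_speed g : Prop :=
  forall s r : R, 0 <= s <= 1 -> 0 <= r <= 1 ->
    mdist (g s) (g r) = `|s - r| * mdist (g 0) (g 1).

Definition geodesic g : Prop := length_minimizer g /\ constant_speed g.

Definition PC_space : Prop :=
  geodesic_space /\
  forall (y : X) g, geodesic g -> forall s : R, 0 <= s <= 1 ->
    mdist (g s) y ^+ 2 >=
      (1 - s) * mdist (g 0) y ^+ 2 + s * mdist (g 1) y ^+ 2
      - s * (1 - s) * mdist (g 0) (g 1) ^+ 2.

End geodesic_spaces.

Section nonnegative_cross_curvature.
Context {R : realType} (X Y : Type) (c : X -> Y -> R).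

Definition variational_c_segment (x : R -> X) (ybar : Y) : Prop :=
  forall (s : R) (y : Y), 0 < s < 1 ->
    c (x s) ybar - c (x s) y <=
      (1 - s) * (c (x 0) ybar - c (x 0) y) + s * (c (x 1) ybar - c (x 1) y).

Definition NNCC_space : Prop :=
  forall (x0 x1 : X) (ybar : Y),
    exists x : R -> X,
      [/\ variational_c_segment x ybar, x 0 = x0 & x 1 = x1].

End nonnegative_cross_curvature.

(* Main.v *)
Require Import Defs.
From HB Require Import structures.
From mathcomp Require Import all_boot all_order all_algebra.
From mathcomp Require Import all_classical all_reals all_analysis.
From mathcomp Require Import ring lra.
Set Implicit Arguments.
Unset Strict Implicit.
Unset Printing Implicit Defensive.
Import Order.TTheory GRing.Theory Num.Theory.
Import numFieldNormedType.Exports.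
Local Open Scope classical_set_scope.
Local Open Scope ring_scope.

(** A variational c-segment whose base point lies on a geodesic between its
    endpoints is pinned to that point, because its defining inequality can be
    tested at points of the segment itself.  Given a geodesic [g] and [0 < s < 1],
    take a variational c-segment [x] from [g 0] to [g 1] whose base point is
    [g s].  Since [g] has constant speed, the segment inequality reads, with
    [D] the distance from [g 0] to [g 1],
      d(x s, g s)^2 + (1 - s) d(g 0, y)^2 + s d(g 1, y)^2 - s (1 - s) D^2
        <= d(x s, y)^2
    for all [y], which is the inequality of positive curvature for the point
    [x s] in place of [g s].  Testing it at [y = x s] forces [x s = g s]: by
    [convex_sqr_dist_ge] the last three terms of the left-hand side are then
    nonnegative together, while the right-hand side vanishes. *)

(** Expanding, [(1 - s) * a ^+ 2 + s * b ^+ 2 - s * (1 - s) * (a + b) ^+ 2] is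
    the square of [(1 - s) * a - s * b]; the rest is the triangle
    inequality. *)
Lemma convex_sqr_dist_ge (R : realFieldType) (X : metricType R) (x0 x1 z : X)
    (s : R) : 0 <= s <= 1 ->
  s * (1 - s) * mdist x0 x1 ^+ 2 <=
    (1 - s) * mdist x0 z ^+ 2 + s * mdist x1 z ^+ 2.
Proof.
move=> /andP[s0 s1].
have tri : mdist x0 x1 <= mdist x0 z + mdist x1 z.
  by rewrite (metric_sym x1 z); exact: metric_triangle.
have sqr_tri : mdist x0 x1 ^+ 2 <= (mdist x0 z + mdist x1 z) ^+ 2.
  by rewrite lerXn2r// nnegrE ?addr_ge0 ?mdist_ge0.
have ss_ge0 : 0 <= s * (1 - s) by rewrite mulr_ge0// subr_ge0.
apply: le_trans (ler_wpM2l ss_ge0 sqr_tri) _.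
rewrite -subr_ge0.
suff -> : (1 - s) * mdist x0 z ^+ 2 + s * mdist x1 z ^+ 2 -
    s * (1 - s) * (mdist x0 z + mdist x1 z) ^+ 2 =
    ((1 - s) * mdist x0 z - s * mdist x1 z) ^+ 2 by exact: sqr_ge0.
by ring.
Qed.

Theorem proposition1p3 (R : realType) (X : metricType R) :
  geodesic_space X ->
  NNCC_space (fun x y : X => mdist x y ^+ 2) ->
  PC_space X.
Proof.
move=> geoX nncc; split=> // y g [_ speed] s /andP[].
rewrite le_eqVlt => /predU1P[<- _|s_gt0]; first by rewrite mul0r; lra.
rewrite le_eqVlt => /predU1P[->|s_lt1]; first by rewrite subrr; lra.
have s01 : 0 <= s <= 1 by rewrite !ltW.
have [x [xseg x0 x1]] := nncc (g 0) (g 1) (g s).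
have d0 : mdist (g 0) (g s) = s * mdist (g 0) (g 1).
  by rewrite speed ?lexx ?ler01// sub0r normrN gtr0_norm.
have d1 : mdist (g 1) (g s) = (1 - s) * mdist (g 0) (g 1).
  by rewrite speed ?lexx ?ler01// gtr0_norm// subr_gt0.
have seg z : mdist (x s) (g s) ^+ 2 + (1 - s) * mdist (g 0) z ^+ 2 +
    s * mdist (g 1) z ^+ 2 - s * (1 - s) * mdist (g 0) (g 1) ^+ 2 <=
    mdist (x s) z ^+ 2.
  have := xseg s z; rewrite s_gt0 s_lt1 => /(_ isT).
  rewrite x0 x1 d0 d1 -subr_ge0 => h; rewrite -subr_ge0.
  by apply: le_trans h _; rewrite le_eqVlt; apply/orP; left; apply/eqP; ring.
have xs : x s = g s.
  apply: mdist_positivity; apply/eqP; rewrite -sqrf_eq0 eq_le sqr_ge0 andbT.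
  have := seg (x s); rewrite mdistxx expr0n /=.
  by have := convex_sqr_dist_ge (g 0) (g 1) (x s) s01; lra.
by have := seg y; rewrite xs mdistxx expr0n /= add0r.
Qed.
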